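(* The predicate modal logic $\mathbf{QGL}$ is sound and complete with respect to the class $\mathcal{C}_{\mathsf{GL}}$ of GL-frames; that is, a formula belongs to $\mathbf{QGL}$ if and only if it is valid in every GL-frame.
   Context: Language: countable set of variables, $\top,\bot,\land,\neg,\forall$, countably many predicate symbols of each arity (0-ary ones are propositional variables), and modal operator $\Box$; $\Diamond=\neg\Box\neg$, $\Diamond^n$ its $n$-fold iterate. $\mathbf{QGL}$ is the set of formulas derivable from: all classical predicate tautologies; $\Box(p\supset q)\supset(\Box p\supset\Box q)$; $\Box p\supset\Box\Box p$; modus ponens; uniform substitution; necessitation ($\phi/\Box\phi$); generalization ($\phi/\forall x\phi$); and the $\omega$-rule: from $p\supset\Diamond^n\top$ for all $n\in\omega$ infer $p\supset\bot$ (as a schema, for all substitution instances of $p$). A neighborhood frame is $Z=\langle C,\mathcal{N}\rangle$ with $C\neq\emptyset$, $\mathcal{N}\colon C\to\mathcal{P}(\mathcal{P}(C))$; $\Box_ZX=\{c\mid X\in\mathcal{N}(c)\}$, $\Diamond_ZX=C\setminus\Box_Z(C\setminus X)$. $Z$ is a GL-frame if: $\Box_Z(X\cap Y)\subseteq\Box_ZX\cap\Box_ZY$, $\Box_ZC=C$, $\Box_ZX\cap\Box_ZY\subseteq\Box_Z(X\cap Y)$, $\Box_ZX\subseteq\Box_Z\Box_ZX$ for all $X,Y\subseteq C$, and $\bigcap_{n\in\omega}\Diamond_Z^nC=\emptyset$. A formula is valid in $Z$ if for every nonempty (constant) domain $\mathcal{D}$, interpretation $\mathcal{I}$ (with $P^{\mathcal{I}}(c)\subseteq\mathcal{D}^n$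 for $n$-ary $P$, $c\in C$) and assignment $\mathcal{A}$ of variables into $\mathcal{D}$, its valuation equals $C$, where valuation is: $\top\mapsto C$, $\bot\mapsto\emptyset$, $P(x_1,\ldots,x_n)\mapsto\{c\mid(\mathcal{A}(x_1),\ldots,\mathcal{A}(x_n))\in P^{\mathcal{I}}(c)\}$, $\land\mapsto\cap$, $\neg\mapsto$ complement, $\forall x\phi\mapsto\bigcap_{d\in\mathcal{D}}v_{[d/x]\mathcal{A}}(\phi)$, $\Box\phi\mapsto\Box_Z v(\phi)$. *)

(* Defs.v *)
From mathcomp Require Import all_boot.
From mathcomp Require Import boolp classical_sets.

Set Implicit Arguments.
Unset Strict Implicit.
Unset Printing Implicit Defensive.

Local Open Scope classical_set_scope.

Definition var := nat.

(* [Atom k xs] with [xs : n.-tuple var] is the [k]-th [n]-ary predicate symbol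
   applied to [xs]. *)
Inductive formula : Type :=
| Top
| Bot
| Atom (n : nat) (k : nat) (xs : n.-tuple var)
| And (phi psi : formula)
| Neg (phi : formula)
| All (x : var) (phi : formula)
| Box (phi : formula).

Definition Imp (phi psi : formula) : formula := Neg (And phi (Neg psi)).
Definition Dia (phi : formula) : formula := Neg (Box (Neg phi)).
Definition PropVar (k : nat) : formula := Atom k [tuple].

Fixpoint fv (phi : formula) : seq var :=
  match phi with
  | Top | Bot => [::]
  | Atom _ _ xs => xs
  | And phi psi => fv phi ++ fv psi
  | Neg phi => fv phi
  | All x phi => [seq y <- fv phi | y != x]
  | Box phi => fv phi
  end.

Definition update (T : Type) (x : var) (d : T) (a : var -> T) : var -> T :=
  fun y => if y == x then d else a y.

(* [x] itself whenever possible, and otherwise a variable not in [l]. *)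
Definition avoid (x : var) (l : seq var) : var :=
  if x \in l then (\max_(y <- l) y).+1 else x.

(* Simultaneous replacement of the free variables of a formula according to
   [s]; a bound variable is renamed exactly when it would capture. *)
Fixpoint rename (s : var -> var) (phi : formula) : formula :=
  match phi with
  | Top => Top
  | Bot => Bot
  | Atom _ k xs => Atom k (map_tuple s xs)
  | And phi psi => And (rename s phi) (rename s psi)
  | Neg phi => Neg (rename s phi)
  | All x phi =>
      let z := avoid x [seq s y | y <- fv (All x phi)] in
      All z (rename (update x z s) phi)
  | Box phi => Box (rename s phi)
  end.

(* A formula with designated pairwise distinct argument variables, to be
   substituted for an [n]-ary predicate symbol. The body may have further free
   variables (parameters) and may contain [Box]. *)
Record abstraction (n : nat) := Abstraction {
  abs_args : n.-tuple var;
  abs_body : formula;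
  abs_uniq : uniq abs_args }.

Definition abs_params (n : nat) (t : abstraction n) : seq var :=
  [seq y <- fv (abs_body t) | y \notin abs_args t].

Definition abs_apply (n : nat) (t : abstraction n) (ys : n.-tuple var) :
    formula :=
  rename (fun x => nth x ys (index x (abs_args t))) (abs_body t).

Definition predsubst := forall n : nat, nat -> abstraction n.

(* The parameters of the abstractions substituted somewhere in [phi]. *)
Fixpoint params (sigma : predsubst) (phi : formula) : seq var :=
  match phi with
  | Top | Bot => [::]
  | Atom n k _ => abs_params (sigma n k)
  | And phi psi => params sigma phi ++ params sigma psi
  | Neg phi => params sigma phi
  | All _ phi => params sigma phi
  | Box phi => params sigma phi
  end.

(* The renaming [s] records how the enclosing quantifiers have been renamed in
   order not to capture parameters of [sigma]. *)
Fixpoint usubst_ren (sigma : predsubst) (s : var -> var) (phi : formula) :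
    formula :=
  match phi with
  | Top => Top
  | Bot => Bot
  | Atom n k xs => abs_apply (sigma n k) (map_tuple s xs)
  | And phi psi => And (usubst_ren sigma s phi) (usubst_ren sigma s psi)
  | Neg phi => Neg (usubst_ren sigma s phi)
  | All x phi =>
      let z := avoid x ([seq s y | y <- fv (All x phi)] ++ params sigma phi) in
      All z (usubst_ren sigma (update x z s) phi)
  | Box phi => Box (usubst_ren sigma s phi)
  end.

Definition usubst (sigma : predsubst) (phi : formula) : formula :=
  usubst_ren sigma id phi.

Fixpoint box_free (phi : formula) : bool :=
  match phi with
  | Top | Bot | Atom _ _ _ => true
  | And phi psi => box_free phi && box_free psi
  | Neg phi => box_free phi
  | All _ phi => box_free phi
  | Box _ => false
  end.

(* Classical first-order satisfaction; only used on [box_free] formulas, so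
   the clause for [Box] is irrelevant. *)
Fixpoint sat (D : Type) (I : forall n : nat, nat -> set (n.-tuple D))
    (a : var -> D) (phi : formula) : Prop :=
  match phi with
  | Top => True
  | Bot => False
  | Atom n k xs => I n k (map_tuple a xs)
  | And phi psi => sat I a phi /\ sat I a psi
  | Neg phi => ~ sat I a phi
  | All x phi => forall d : D, sat I (update x d a) phi
  | Box _ => False
  end.

Definition classical_tautology (phi : formula) : Prop :=
  box_free phi /\
  forall (D : Type) (I : forall n : nat, nat -> set (n.-tuple D))
    (a : var -> D), inhabited D -> sat I a phi.

Inductive QGL : formula -> Prop :=
| QGL_taut phi : classical_tautology phi -> QGL phi
| QGL_K :
    QGL (Imp (Box (Imp (PropVar 0) (PropVar 1)))
             (Imp (Box (PropVar 0)) (Box (PropVar 1))))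
| QGL_4 : QGL (Imp (Box (PropVar 0)) (Box (Box (PropVar 0))))
| QGL_mp phi psi : QGL (Imp phi psi) -> QGL phi -> QGL psi
| QGL_usubst sigma phi : QGL phi -> QGL (usubst sigma phi)
| QGL_nec phi : QGL phi -> QGL (Box phi)
| QGL_gen x phi : QGL phi -> QGL (All x phi)
| QGL_omega phi :
    (forall n : nat, QGL (Imp phi (iter n Dia Top))) -> QGL (Imp phi Bot).

Record nbhd_frame := NbhdFrame {
  world : Type;
  nbhd : world -> set (set world);
  world_inhabited : inhabited world }.

Definition boxZ (Z : nbhd_frame) (X : set (world Z)) : set (world Z) :=
  [set c | nbhd c X].

Definition diaZ (Z : nbhd_frame) (X : set (world Z)) : set (world Z) :=
  ~` boxZ (~` X).

Record GL_frame (Z : nbhd_frame) : Prop := {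
  GL_mono : forall X Y : set (world Z),
    boxZ (X `&` Y) `<=` boxZ X `&` boxZ Y;
  GL_top : boxZ [set: world Z] = [set: world Z];
  GL_meet : forall X Y : set (world Z),
    boxZ X `&` boxZ Y `<=` boxZ (X `&` Y);
  GL_trans : forall X : set (world Z), boxZ X `<=` boxZ (boxZ X);
  GL_omega : \bigcap_n iter n (@diaZ Z) [set: world Z] = set0 }.

Fixpoint valuation (Z : nbhd_frame) (D : Type)
    (I : forall n : nat, nat -> world Z -> set (n.-tuple D))
    (a : var -> D) (phi : formula) : set (world Z) :=
  match phi with
  | Top => setT
  | Bot => set0
  | Atom n k xs => [set c | I n k c (map_tuple a xs)]
  | And phi psi => valuation I a phi `&` valuation I a psi
  | Neg phi => ~` valuation I a phi
  | All x phi => \bigcap_(d : D) valuation I (update x d a) phi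
  | Box phi => boxZ (valuation I a phi)
  end.

Definition valid_in (Z : nbhd_frame) (phi : formula) : Prop :=
  forall (D : Type) (I : forall n : nat, nat -> world Z -> set (n.-tuple D))
    (a : var -> D), inhabited D -> valuation I a phi = [set: world Z].

(* Main.v *)
From mathcomp Require Import all_boot.
From mathcomp Require Import boolp classical_sets.
Require Import Defs.

(* Completeness: the worlds are the maximal consistent sets of formulas, with
   the variables as Henkin witnesses, that omit some [Dia^n Top].  Every
   consistent formula lies in such a set: in the enumeration of all formulas
   each stage is a single formula, so fresh witnesses never run out, and the
   omega-rule read contrapositively yields an [n] for which [~ Dia^n Top] may be
   added at the start.  The neighborhoods of [F] are the supersets of the sets
   [{G | A in G}] with [Box A] in [F]; as no accessibility relation is involved,
   the Barcan formula is not needed for a constant domain.  The domain is the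
   set of variables, and an assignment acts on formulas by renaming, which
   composes only up to provable equivalence. *)

Set Implicit Arguments.
Unset Strict Implicit.
Unset Printing Implicit Defensive.

Local Open Scope classical_set_scope.

Lemma avoid_notin x l : avoid x l \notin l.
Proof.
rewrite /avoid; case: ifP => [_|/negbT //]; apply/negP => zl.
by have := @leq_bigmax_seq _ l xpredT id _ zl isT; rewrite ltnn.
Qed.

Lemma avoid_id x l : x \notin l -> avoid x l = x.
Proof. by rewrite /avoid => /negbTE ->. Qed.

Lemma mem_fv_All x y phi : y != x -> y \in fv phi -> y \in fv (All x phi).
Proof. by move=> yx yp; rewrite mem_filter yx. Qed.

Lemma notin_fv_All x phi : x \notin fv (All x phi).
Proof. by rewrite mem_filter eqxx. Qed.

Lemma update_id x : update x x id = id.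
Proof. by apply: funext => y; rewrite /update; case: eqP. Qed.

Lemma update_eq (T : Type) x (d : T) a : update x d a x = d.
Proof. by rewrite /update eqxx. Qed.

(** * Renaming *)

Lemma rename_ext phi s t : {in fv phi, s =1 t} -> rename s phi = rename t phi.
Proof.
elim: phi s t => //= [n k xs|phi IH1 psi IH2|phi IH|x phi IH|phi IH] s t st.
- by congr Atom; apply: val_inj; apply/eq_in_map.
- by congr And; [apply: IH1|apply: IH2] => y yp;
    apply: st; rewrite mem_cat yp ?orbT.
- by congr Neg; apply: IH.
- have -> : [seq s y | y <- fv phi & y != x] = [seq t y | y <- fv phi & y != x].
    exact/eq_in_map.
  congr All; apply: IH => y yp; rewrite /update.
  by case: eqP => // /eqP yx; apply/st/mem_fv_All.
- by congr Box; apply: IH.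
Qed.

Lemma rename_id phi : rename id phi = phi.
Proof.
elim: phi => //= [n k xs|phi -> psi ->|phi ->|x phi IH|phi ->] //.
- by congr Atom; apply: val_inj; rewrite /= map_id.
- by rewrite map_id avoid_id ?notin_fv_All// update_id IH.
Qed.

(** In the quantifier case the new bound variable is not the image of any free variable, so
    discarding it removes exactly what the bound [x] contributes. *)
Lemma fv_rename s phi : fv (rename s phi) =i [seq s y | y <- fv phi].
Proof.
elim: phi s => //= [phi IH1 psi IH2|x phi IH] s y.
  by rewrite map_cat !mem_cat IH1 IH2.
set z := avoid _ _.
have zP : z \notin [seq s y | y <- fv (All x phi)] by apply: avoid_notin.
rewrite mem_filter IH; apply/andP/mapP => [[yz /mapP[u up yE]]|[u uP yE]].
  move: yE; rewrite /update; case: eqP => [_ yE|/eqP ux yE].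
    by rewrite yE eqxx in yz.
  by exists u => //; apply: mem_fv_All.
have /= := uP; rewrite mem_filter => /andP[ux up].
split; last by apply/mapP; exists u => //; rewrite /update (negbTE ux).
by apply: contra zP => /eqP <-; rewrite yE map_f.
Qed.

(** * Soundness *)

Section Valuation.
Variables (Z : nbhd_frame) (D : Type).
Implicit Types (I : forall n : nat, nat -> world Z -> set (n.-tuple D)).
Implicit Types (a b : var -> D).

Lemma valuation_ext I a b phi :
  {in fv phi, a =1 b} -> valuation I a phi = valuation I b phi.
Proof.
elim: phi a b => //= [n k xs|phi IH1 psi IH2|phi IH|x phi IH|phi IH] a b ab.
- suff -> : map_tuple a xs = map_tuple b xs by [].
  by apply: val_inj; apply/eq_in_map.
- by congr (_ `&` _); [apply: IH1|apply: IH2] => y yp;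
    apply: ab; rewrite mem_cat yp ?orbT.
- by congr (~` _); apply: IH.
- apply: eq_bigcapr => d _; apply: IH => y yp; rewrite /update.
  by case: eqP => // /eqP yx; apply/ab/mem_fv_All.
- by congr boxZ; apply: IH.
Qed.

(** The common core of all quantifier cases: [z] stands in for [x] without capture. It serves
    valuations and, with [D := var], compositions of renamings. *)
Lemma update_comp_update (x z : var) (d : D) a (s : var -> var) phi :
  z \notin [seq s y | y <- fv (All x phi)] ->
  {in fv phi, update z d a \o update x z s =1 update x d (a \o s)}.
Proof.
move=> zP y yp; rewrite /update /=; case: (eqVneq y x) => [_|yx].
  by rewrite eqxx.
by case: eqP => // yz; case/negP: zP; rewrite -yz; apply/map_f/mem_fv_All.
Qed.

Lemma valuation_rename I a s phi :
  valuation I a (rename s phi) = valuation I (a \o s) phi.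
Proof.
elim: phi a s => //= [n k xs|phi IH1 psi IH2|phi IH|x phi IH|phi IH] a s.
- suff -> : map_tuple a (map_tuple s xs) = map_tuple (a \o s) xs by [].
  by apply: val_inj; rewrite /= map_comp.
- by rewrite IH1 IH2.
- by rewrite IH.
- apply: eq_bigcapr => d _; rewrite IH; apply: valuation_ext.
  exact/update_comp_update/avoid_notin.
- by rewrite IH.
Qed.

(** A symbol is read as the truth set of the body substituted for it. A variable that is not an
    argument has an index past the end of [ds], so the default [b u] gives the value of a
    parameter. *)
Definition subst_interp (sigma : predsubst) I b :
    forall n : nat, nat -> world Z -> set (n.-tuple D) :=
  fun n k c ds =>
    valuation I (fun u => nth (b u) ds (index u (abs_args (sigma n k))))
      (abs_body (sigma n k)) c.

(** Under quantifiers [a] changes while [b] stays fixed; the two keep agreeing on the parameters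
    because each new bound variable avoids them. *)
Lemma valuation_usubst_ren sigma I b phi a s :
  {in params sigma phi, a =1 b} ->
  valuation I a (usubst_ren sigma s phi) =
  valuation (subst_interp sigma I b) (a \o s) phi.
Proof.
elim: phi a s => //= [n k xs|phi IH1 psi IH2|phi IH|x phi IH|phi IH] a s ab.
- rewrite /abs_apply valuation_rename; apply/seteqP.
  suff -> : valuation I
      (a \o (fun x => nth x (map_tuple s xs) (index x (abs_args (sigma n k)))))
      (abs_body (sigma n k)) =
    valuation I
      (fun u => nth (b u) (map_tuple (a \o s) xs)
                          (index u (abs_args (sigma n k))))
      (abs_body (sigma n k)) by split.
  apply: valuation_ext => u up /=; rewrite map_comp.
  (* An argument is looked up inside both tuples; for a parameter both lookups return their
     defaults, and there [a] agrees with [b]. *)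
  have [uargs|uargs] := boolP (u \in abs_args (sigma n k)).
    rewrite [RHS](nth_map u) // size_map size_tuple.
    by rewrite -[X in _ < X](size_tuple (abs_args (sigma n k))) index_mem.
  rewrite !nth_default ?size_map ?size_tuple //.
  + by apply: ab; rewrite mem_filter uargs.
  + by rewrite -[X in X <= _](size_tuple (abs_args (sigma n k))) leqNgt index_mem.
  + by rewrite -[X in X <= _](size_tuple (abs_args (sigma n k))) leqNgt index_mem.
- by rewrite IH1 1?IH2 // => y yp; apply: ab; rewrite mem_cat yp ?orbT.
- by rewrite IH.
- set z := avoid _ _; have := avoid_notin x
    ([seq s y | y <- fv (All x phi)] ++ params sigma phi).
  rewrite -/z mem_cat negb_or => /andP[zfv zpar].
  apply: eq_bigcapr => d _; rewrite IH => [|y yp].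
    exact/valuation_ext/update_comp_update.
  rewrite /update; case: eqP => [yz|_]; last exact: ab.
  by rewrite -yz yp in zpar.
- by rewrite IH.
Qed.

Lemma valuation_usubst sigma I a phi :
  valuation I a (usubst sigma phi) = valuation (subst_interp sigma I a) a phi.
Proof. exact: valuation_usubst_ren. Qed.

Lemma valuation_sat I a phi c : box_free phi ->
  valuation I a phi c <-> sat (fun n k => I n k c) a phi.
Proof.
elim: phi a => //= [phi IH1 psi IH2|phi IH|x phi IH] a.
- by case/andP => b1 b2; rewrite -IH1// -IH2.
- by move=> b; rewrite -IH.
- by move=> b; split=> h d => [|_]; apply/IH => //; exact: h.
Qed.

Lemma valuation_Imp I a phi psi :
  valuation I a (Imp phi psi) = setT <->
  valuation I a phi `<=` valuation I a psi.
Proof.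
rewrite /= -subTset; split=> h c => [hc|_ [hc]]; last by apply; apply: h.
by apply: contrapT => nc; apply: (h c).
Qed.

Lemma valuation_iter_Dia I a n :
  valuation I a (iter n Dia Top) = iter n (@diaZ Z) setT.
Proof. by elim: n => //= n ->. Qed.

End Valuation.

Lemma boxZS Z (X Y : set (world Z)) : GL_frame Z ->
  X `<=` Y -> boxZ X `<=` boxZ Y.
Proof. by move=> gl /setIidPl <- c /(GL_mono gl) []. Qed.

Lemma soundness phi : QGL phi -> forall Z, GL_frame Z -> valid_in Z phi.
Proof.
move=> + Z gl; elim=> {phi}
  [phi [bf taut]| | |phi psi _ IH1 _ IH2|sigma phi _ IH|phi _ IH|x phi _ IH|phi _ IH]
  D I a D0.
- by rewrite -subTset => c _; apply/valuation_sat => //; apply: taut.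
- apply/valuation_Imp => c /= h [p]; apply; apply: (boxZS gl _ (GL_meet gl (conj h p))).
  move=> d [/= d1 d2].
  by apply: contrapT => d3; apply: d1.
- by apply/valuation_Imp; apply: GL_trans.
- by move: (IH1 D I a D0); rewrite valuation_Imp IH2// subTset.
- by rewrite valuation_usubst; apply: IH.
- by rewrite /= IH//; apply: GL_top.
- by rewrite /= -subTset => c _ d _; have -> := IH D I (update x d a) D0.
(* The empty truth set of [Bot] is rewritten as the intersection in [GL_omega], so the infinitely
   many premises give membership one [n] at a time. *)
- apply/valuation_Imp; rewrite /= -(GL_omega gl) => c hc n _.
  by rewrite -(valuation_iter_Dia I a); have /valuation_Imp := IH n D I a D0; apply.
Qed.

(** * Derived rules *)

Definition abs0 (phi : formula) : abstraction 0 :=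
  @Abstraction 0 [tuple] phi isT.
Definition abs1 (x : var) (phi : formula) : abstraction 1 :=
  @Abstraction 1 [tuple x] phi isT.
Definition absTop (n : nat) : abstraction n :=
  @Abstraction n [tuple of iota 0 n] Top (iota_uniq 0 n).

(** Schemas are obtained from fixed formulas: nullary symbols stand for arbitrary formulas, a unary
    symbol for a formula with a distinguished variable [x]. *)
Definition subst01 (f : nat -> formula) (x : var) (phi : formula) : predsubst :=
  fun n => match n with
  | 0 => fun k => abs0 (f k)
  | 1 => fun=> abs1 x phi
  | n.+2 => fun=> absTop n.+2
  end.

Lemma abs_apply0 phi xs : abs_apply (abs0 phi) xs = phi.
Proof.
rewrite /abs_apply -[RHS]rename_id; apply: rename_ext => x _ /=.
by rewrite tuple0.
Qed.

Lemma abs_apply1 x phi y :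
  abs_apply (abs1 x phi) [tuple y] = rename (update x y id) phi.
Proof.
rewrite /abs_apply; apply: rename_ext => u _ /=.
by rewrite /update eq_sym; case: eqP.
Qed.

Lemma QGL_prop (l : seq formula) phi :
  classical_tautology phi -> QGL (usubst (subst01 (nth Top l) 0 Top) phi).
Proof. by move=> t; apply/QGL_usubst/QGL_taut. Qed.

(* Glivenko: after [contrapT] the propositional goal is intuitionistic. *)
Ltac prop_instance l p :=
  have := @QGL_prop l p; rewrite /usubst /= !abs_apply0 /=; apply;
  split=> // D I a _; rewrite /Imp /=; apply: contrapT; tauto.

Notation P0 := (PropVar 0).
Notation P1 := (PropVar 1).
Notation P2 := (PropVar 2).

Lemma QGL_const A B : QGL A -> QGL (Imp B A).
Proof.
apply: QGL_mp.
prop_instance [:: A; B] (Imp P0 (Imp P1 P0)).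
Qed.

Lemma QGL_refl A : QGL (Imp A A).
Proof. prop_instance [:: A] (Imp P0 P0). Qed.

Lemma QGL_trans A B C : QGL (Imp A B) -> QGL (Imp B C) -> QGL (Imp A C).
Proof.
move=> ab; apply: QGL_mp; move: ab; apply: QGL_mp.
prop_instance [:: A; B; C]
  (Imp (Imp P0 P1) (Imp (Imp P1 P2) (Imp P0 P2))).
Qed.

Lemma QGL_andl A B : QGL (Imp (And A B) A).
Proof. prop_instance [:: A; B] (Imp (And P0 P1) P0). Qed.

Lemma QGL_andr A B : QGL (Imp (And A B) B).
Proof. prop_instance [:: A; B] (Imp (And P0 P1) P1). Qed.

Lemma QGL_and A B C : QGL (Imp C A) -> QGL (Imp C B) -> QGL (Imp C (And A B)).
Proof.
move=> ca; apply: QGL_mp; move: ca; apply: QGL_mp.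
prop_instance [:: A; B; C]
  (Imp (Imp P2 P0) (Imp (Imp P2 P1) (Imp P2 (And P0 P1)))).
Qed.

Lemma QGL_and_mono A B A' B' : QGL (Imp A A') -> QGL (Imp B B') ->
  QGL (Imp (And A B) (And A' B')).
Proof.
by move=> a b; apply: QGL_and; [apply: QGL_trans (QGL_andl _ _) a|
  apply: QGL_trans (QGL_andr _ _) b].
Qed.

Lemma QGL_pair A B : QGL (Imp A (Imp B (And A B))).
Proof. prop_instance [:: A; B] (Imp P0 (Imp P1 (And P0 P1))). Qed.

Lemma QGL_mp_in A B C :
  QGL (Imp C (Imp A B)) -> QGL (Imp C A) -> QGL (Imp C B).
Proof.
move=> cab; apply: QGL_mp; move: cab; apply: QGL_mp.
prop_instance [:: A; B; C]
  (Imp (Imp P2 (Imp P0 P1)) (Imp (Imp P2 P0) (Imp P2 P1))).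
Qed.

Lemma QGL_contra A B : QGL (Imp A B) -> QGL (Imp (Neg B) (Neg A)).
Proof.
apply: QGL_mp.
prop_instance [:: A; B] (Imp (Imp P0 P1) (Imp (Neg P1) (Neg P0))).
Qed.

Lemma QGL_abs A B : QGL (Imp A (Neg B)) -> QGL (Imp A B) -> QGL (Neg A).
Proof.
move=> h; apply: QGL_mp; move: h; apply: QGL_mp.
prop_instance [:: A; B]
  (Imp (Imp P0 (Neg P1)) (Imp (Imp P0 P1) (Neg P0))).
Qed.

Lemma QGL_cases A B : QGL (Neg (And A B)) -> QGL (Neg (And A (Neg B))) ->
  QGL (Neg A).
Proof.
move=> h; apply: QGL_mp; move: h; apply: QGL_mp.
prop_instance [:: A; B]
  (Imp (Neg (And P0 P1)) (Imp (Neg (And P0 (Neg P1))) (Neg P0))).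
Qed.

Lemma QGL_box_mono A B : QGL (Imp A B) -> QGL (Imp (Box A) (Box B)).
Proof.
move=> /QGL_nec; apply: QGL_mp.
have := QGL_usubst (subst01 (nth Top [:: A; B]) 0 Top) QGL_K.
by rewrite /usubst /= !abs_apply0.
Qed.

Lemma QGL_box_and A B : QGL (Imp (And (Box A) (Box B)) (Box (And A B))).
Proof.
apply: (@QGL_mp_in (Box B)); last exact: QGL_andr.
apply: QGL_trans (QGL_andl _ _) _.
apply: QGL_trans (QGL_box_mono (QGL_pair A B)) _.
have := QGL_usubst (subst01 (nth Top [:: B; And A B]) 0 Top) QGL_K.
by rewrite /usubst /= !abs_apply0.
Qed.

Lemma QGL_box4 A : QGL (Imp (Box A) (Box (Box A))).
Proof.
have := QGL_usubst (subst01 (nth Top [:: A]) 0 Top) QGL_4.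
by rewrite /usubst /= !abs_apply0.
Qed.

Lemma map_tuple1 (T U : Type) (f : T -> U) x : map_tuple f [tuple x] = [tuple f x].
Proof. exact: val_inj. Qed.

(** Substitution of [abs1 x A] for the predicate in a first-order validity. As [x] is no parameter
    of this abstraction, the binder keeps its name. *)
Lemma QGL_all_elim x y A : QGL (Imp (All x A) (rename (update x y id) A)).
Proof.
have : classical_tautology
    (Imp (All x (Atom 0 [tuple x])) (Atom 0 [tuple y])).
  split=> // D I a _; rewrite /Imp /= => -[h]; apply.
  by have := h (a y); rewrite !map_tuple1 update_eq.
move=> /QGL_taut /(QGL_usubst (subst01 (fun=> Top) x A)).
rewrite /usubst /= eqxx /= avoid_id; last by rewrite mem_filter inE eqxx.
by rewrite !map_tuple1 !update_id !abs_apply1 !update_id rename_id.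
Qed.

(** After generalization over [y], an instance of a first-order validity moves the quantifier
    inwards and renames it to [x]. The two freshness hypotheses say that [y] is not a parameter, so
    substitution leaves the binder [y] alone. *)
Lemma QGL_all_intro x y A C : y \notin fv C -> y \notin fv (All x A) ->
  QGL (Imp C (rename (update x y id) A)) -> QGL (Imp C (All x A)).
Proof.
move=> yC yA /(QGL_gen y); apply: QGL_mp.
have : classical_tautology
    (Imp (All y (Imp P0 (Atom 0 [tuple y]))) (Imp P0 (All x (Atom 0 [tuple x])))).
  split=> // D I a _; rewrite /Imp /= => -[h]; apply=> -[p]; apply=> d.
  apply: contrapT => nd; apply: (h d).
  rewrite (tuple0 (map_tuple _ _)) map_tuple1 update_eq; split=> //.
    by rewrite -(tuple0 (map_tuple a [tuple])).
  by move: nd; rewrite map_tuple1 update_eq.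
move=> /QGL_taut /(QGL_usubst (subst01 (fun=> C) x A)).
rewrite /usubst /= !eqxx /= !avoid_id.
- by rewrite !map_tuple1 !update_id !abs_apply1 !abs_apply0 !update_id rename_id.
- by rewrite eqxx mem_filter inE eqxx.
- rewrite mem_cat !mem_filter negb_or (negbTE yC) andbF /=.
  by move: yA; rewrite /= mem_filter inE.
Qed.

(** * Provable equivalence of renamed formulas *)

Definition equiv A B := QGL (Imp A B) /\ QGL (Imp B A).

Lemma equiv_refl A : equiv A A.
Proof. by split; apply: QGL_refl. Qed.

Lemma equiv_trans A B C : equiv A B -> equiv B C -> equiv A C.
Proof.
by move=> [ab ba] [bc cb]; split; [apply: QGL_trans bc|apply: QGL_trans ba].
Qed.

Lemma QGL_all_mono x A B : QGL (Imp A B) -> QGL (Imp (All x A) (All x B)).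
Proof.
move=> ab; apply: (@QGL_all_intro x x); try exact: notin_fv_All.
rewrite update_id rename_id; apply: QGL_trans ab.
by have := QGL_all_elim x x A; rewrite update_id rename_id.
Qed.

(** Renaming in two steps may pick another bound variable ([w]) than renaming at once ([w']), so the
    quantifier case needs a change of bound variable. *)
Lemma rename_comp phi s t :
  equiv (rename s (rename t phi)) (rename (s \o t) phi).
Proof.
elim: phi s t => /= [| |n k xs|phi IH1 psi IH2|phi IH|x phi IH|phi IH] s t.
- exact: equiv_refl.
- exact: equiv_refl.
- have -> : map_tuple s (map_tuple t xs) = map_tuple (s \o t) xs.
    by apply: val_inj; rewrite /= map_comp.
  exact: equiv_refl.
- have [p1 p2] := IH1 s t; have [q1 q2] := IH2 s t.
  by split; apply: QGL_and_mono.
- by have [h1 h2] := IH s t; split; apply: QGL_contra.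
(* Change of bound variable: instantiate [w] by [w'], merge the two renamings of the body by the
   induction hypothesis, and generalize over [w']. *)
- have alpha r w w' : w \notin [seq r y | y <- fv (All x phi)] ->
      w' \notin [seq r y | y <- fv (All x phi)] ->
      QGL (Imp (All w (rename (update x w r) phi))
               (All w' (rename (update x w' r) phi))).
    have fvE v v' : v \notin [seq r y | y <- fv (All x phi)] ->
        v \notin fv (All v' (rename (update x v' r) phi)).
      apply: contra; rewrite mem_filter fv_rename => /andP[vv' /mapP[u up uE]].
      move: uE; rewrite /update; case: eqP => [_ /eqP|/eqP ux ->].
        by rewrite (negbTE vv').
      exact/map_f/mem_fv_All.
    move=> wP wP'; apply: (@QGL_all_intro w' w'); rewrite ?fvE//.
    rewrite update_id rename_id.
    apply: QGL_trans (QGL_all_elim w w' _) _.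
    apply: QGL_trans (IH _ _).1 _.
    by rewrite (rename_ext (update_comp_update w' id wP)); apply: QGL_refl.
  set z := avoid x [seq t y | y <- _].
  have zP : z \notin [seq t y | y <- fv (All x phi)] by apply: avoid_notin.
  set w := avoid z _; set w' := avoid x _.
  have wP' : w' \notin [seq (s \o t) y | y <- fv (All x phi)] by apply: avoid_notin.
  have wP : w \notin [seq (s \o t) y | y <- fv (All x phi)].
    have := avoid_notin z [seq s y | y <- fv (rename t (All x phi))].
    apply: contra => /mapP[u up wE].
    rewrite [avoid _ _]wE; apply/mapP; exists (t u) => //.
    by rewrite fv_rename map_f.
  (* The intermediate formula has the composed renaming in its body but still the bound variable of
     the two-step side. *)
  apply: (@equiv_trans _ (All w (rename (update x w (s \o t)) phi))).
    rewrite -(rename_ext (update_comp_update w s zP)).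
    by have [h1 h2] := IH (update z w s) (update x z t); split; apply: QGL_all_mono.
  by split; apply: alpha.
- by have [h1 h2] := IH s t; split; apply: QGL_box_mono.
Qed.

(** * Henkin sets and the canonical frame *)

(** Generic trees over a countable type are countable, which yields the enumeration. The arity of an
    atom is recovered as the length of its argument list. *)
Fixpoint code (phi : formula) : GenTree.tree (nat * seq nat) :=
  match phi with
  | Top => GenTree.Node 0 [::]
  | Bot => GenTree.Node 1 [::]
  | Atom n k xs => GenTree.Leaf (k, val xs)
  | And phi psi => GenTree.Node 2 [:: code phi; code psi]
  | Neg phi => GenTree.Node 3 [:: code phi]
  | All x phi => GenTree.Node 4 [:: GenTree.Leaf (x, [::]); code phi]
  | Box phi => GenTree.Node 5 [:: code phi]
  end.

Fixpoint decode (t : GenTree.tree (nat * seq nat)) : formula :=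
  match t with
  | GenTree.Node 1 _ => Bot
  | GenTree.Leaf (k, xs) => Atom k (in_tuple xs)
  | GenTree.Node 2 [:: t; u] => And (decode t) (decode u)
  | GenTree.Node 3 [:: t] => Neg (decode t)
  | GenTree.Node 4 [:: GenTree.Leaf (x, _); t] => All x (decode t)
  | GenTree.Node 5 [:: t] => Box (decode t)
  | _ => Top
  end.

Lemma codeK : cancel code decode.
Proof.
elim=> //= [n k [xs sz]|phi -> psi ->|phi ->|x phi ->|phi ->] //=.
by have nE := eqP sz; subst n; congr Atom; apply: val_inj.
Qed.

Definition enum_formula (n : nat) : formula :=
  if unpickle n is Some t then decode t else Top.

Lemma enum_formula_surj phi : exists n, enum_formula n = phi.
Proof. by exists (pickle (code phi)); rewrite /enum_formula pickleK codeK. Qed.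

(** [henkin_neg] is consistency and maximality at once; [henkin_all] is the witness property in
    contrapositive form. *)
Record henkin (F : set formula) : Prop := {
  henkin_imp : forall A B, QGL (Imp A B) -> F A -> F B;
  henkin_and : forall A B, F A -> F B -> F (And A B);
  henkin_neg : forall A, F (Neg A) <-> ~ F A;
  henkin_all : forall x A,
    (forall y, F (rename (update x y id) A)) -> F (All x A);
  henkin_omega : exists n, ~ F (iter n Dia Top) }.

(** * Extending a consistent formula to a Henkin set *)

Definition consistent A := ~ QGL (Neg A).

Definition decides A phi :=
  QGL (Imp A phi) \/
  QGL (Imp A (Neg phi)) /\
  forall x psi, phi = All x psi ->
    exists y, QGL (Imp A (Neg (rename (update x y id) psi))).

Lemma consistent_decide A phi : consistent A ->
  exists B, [/\ consistent B, QGL (Imp B A) & decides B phi].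
Proof.
move=> cA; have [c1|c1] := EM (consistent (And A phi)).
  by exists (And A phi); split=> //; [apply: QGL_andl|left; apply: QGL_andr].
set B := And A (Neg phi).
have cB : consistent B.
  by move=> c2; apply: cA; apply: QGL_cases (contrapT c1) c2.
have BA : QGL (Imp B A) by apply: QGL_andl.
have Bphi : QGL (Imp B (Neg phi)) by apply: QGL_andr.
have [[x [psi E]]|nall] := EM (exists x psi, phi = All x psi); last first.
  by exists B; split=> //; right; split=> // x psi E; case: nall; exists x, psi.
(* [y] is fresh: refuting [B /\ ~ psi(y)] would yield [B -> All x psi]. *)
pose y := avoid 0 (fv B ++ fv (All x psi)).
have := avoid_notin 0 (fv B ++ fv (All x psi)).
rewrite -/y mem_cat negb_or => /andP[yB ypsi].
exists (And B (Neg (rename (update x y id) psi))); split.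
- move=> c; apply: cB; apply: QGL_abs Bphi _; rewrite E.
  exact: QGL_all_intro c.
- exact: QGL_trans (QGL_andl _ _) BA.
- right; split; first exact: QGL_trans (QGL_andl _ _) Bphi.
  by move=> x' psi'; rewrite E => -[-> ->]; exists y; apply: QGL_andr.
Qed.

(** [Neg (And A (Neg B))] is [Imp A B] by definition, so failure for every [n] is exactly the
    premise of [QGL_omega]. *)
Lemma consistent_omega A : consistent A ->
  exists n, consistent (And A (Neg (iter n Dia Top))).
Proof.
move=> cA; apply: contrapT => /forallNP h; apply: cA.
apply: QGL_abs (QGL_omega (fun n => contrapT (h n))).
by apply/QGL_const/QGL_taut; split=> // D I a _ [].
Qed.

Lemma henkin_exists A : consistent A -> exists2 F, henkin F & F A.
Proof.
move=> /consistent_omega[n cA]; set A0 := And A _ in cA.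
(* Consistency travels with the formula, so that the choice made by [cid] can be iterated. *)
have step (B : {B | consistent B}) (m : nat) : {C : {C | consistent C} |
    QGL (Imp (sval C) (sval B)) /\ decides (sval C) (enum_formula m)}.
  apply: cid; have [C [cC CB dC]] := consistent_decide (enum_formula m) (svalP B).
  by exists (exist _ C cC).
pose G := fix G m := if m is m'.+1 then sval (step (G m') m') else exist _ A0 cA.
have GS m : QGL (Imp (sval (G m.+1)) (sval (G m))).
  exact: (svalP (step (G m) m)).1.
have Gle m m' : m <= m' -> QGL (Imp (sval (G m')) (sval (G m))).
  move=> /subnK <-; elim: (m' - m) => [|k IH]; first exact: QGL_refl.
  exact: QGL_trans (GS _) IH.
have Gdec phi : exists m, decides (sval (G m)) phi.
  have [m <-] := enum_formula_surj phi; exists m.+1.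
  exact: (svalP (step (G m) m)).2.
(* Later stages imply earlier ones, so finitely many members of [F] follow from one common stage. *)
pose F phi := exists m, QGL (Imp (sval (G m)) phi).
have Fimp B C : QGL (Imp B C) -> F B -> F C.
  by move=> BC [m mB]; exists m; apply: QGL_trans BC.
have Fincons B : F B -> F (Neg B) -> False.
  move=> [m mB] [m' mB']; apply: (svalP (G (maxn m m'))).
  by apply: (@QGL_abs _ B); [apply: QGL_trans mB'|apply: QGL_trans mB];
    apply: Gle; rewrite ?leq_maxl ?leq_maxr.
have Fneg B : F (Neg B) <-> ~ F B.
  split=> [nB /Fincons|nB]; first by apply.
  have [m [mB|[mB _]]] := Gdec B; last by exists m.
  by case: nB; exists m.
exists F; last by exists 0; apply: QGL_andl.
split=> //.
- move=> B C [m mB] [m' mC]; exists (maxn m m').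
  by apply: QGL_and; [apply: QGL_trans mB|apply: QGL_trans mC];
    apply: Gle; rewrite ?leq_maxl ?leq_maxr.
- move=> x psi h; have [m [mB|[_ /(_ _ _ erefl) [y my]]]] := Gdec (All x psi).
    by exists m.
  by case: (Fincons _ (h y)); exists m.
- exists n; apply/Fneg; exists 0; exact: QGL_andr.
Qed.

Lemma henkin_QGL F A : henkin F -> QGL A -> F A.
Proof.
move=> hF pA; apply: contrapT => nFA.
have FnA : F (Neg A) by apply/(henkin_neg hF).
by apply: nFA; apply: henkin_imp FnA => //; apply: QGL_const.
Qed.

(** An unprovable implication makes [And A (Neg B)] consistent, and a Henkin set containing it is a
    counterexample. *)
Lemma QGL_henkin A B : (forall F, henkin F -> F A -> F B) -> QGL (Imp A B).
Proof.
move=> h; apply: contrapT => /henkin_exists[F hF FAB].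
have FA : F A by apply: henkin_imp FAB => //; apply: QGL_andl.
have : F (Neg B) by apply: henkin_imp FAB => //; apply: QGL_andr.
by move=> /(henkin_neg hF); apply; apply: h.
Qed.

(** * The canonical frame and the truth lemma *)

Definition canonical_world := {F : set formula | henkin F}.

Definition ext (A : formula) : set canonical_world := [set F | sval F A].

Section Canonical.
Variable F0 : canonical_world.

Definition canonical_frame : nbhd_frame :=
  @NbhdFrame canonical_world
    (fun F => [set X | exists2 A, sval F (Box A) & ext A `<=` X])
    (inhabits F0).

(** Closing neighborhoods upwards adds no new definable ones: an inclusion [ext B] in [ext A] is a
    provable implication by [QGL_henkin], and [Box] is monotone. *)
Lemma boxZ_ext A : @boxZ canonical_frame (ext A) = ext (Box A).
Proof.
apply/seteqP; split=> [F [B FB BA]|F FA]; last by exists A.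
apply: (henkin_imp (svalP F) _ FB); apply/QGL_box_mono/QGL_henkin => G hG.
exact: (BA (exist _ G hG)).
Qed.

Lemma ext_Neg A : ext (Neg A) = ~` ext A.
Proof. by apply/seteqP; split=> F /(henkin_neg (svalP F)). Qed.

Lemma ext_Top : ext Top = setT.
Proof.
rewrite -subTset => F _; apply: henkin_QGL (svalP F) _.
by apply: QGL_taut; split.
Qed.

Lemma ext_And A B : ext (And A B) = ext A `&` ext B.
Proof.
apply/seteqP; split=> F => [FAB|[FA FB]]; last exact: henkin_and (svalP F) _ _ _ _.
by split; apply: (henkin_imp (svalP F) _ FAB); [apply: QGL_andl|apply: QGL_andr].
Qed.

Lemma ext_equiv A B : equiv A B -> ext A = ext B.
Proof.
by move=> [ab ba]; apply/seteqP; split=> F; apply: (henkin_imp (svalP F)).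
Qed.

Lemma ext_All x A : ext (All x A) = \bigcap_y ext (rename (update x y id) A).
Proof.
apply/seteqP; split=> F => [FA y _|h].
  by apply: (henkin_imp (svalP F) _ FA); apply: QGL_all_elim.
by apply: (henkin_all (svalP F)) => y; apply: h.
Qed.

Lemma diaZ_ext A : @diaZ canonical_frame (ext A) = ext (Dia A).
Proof. by rewrite /diaZ -ext_Neg boxZ_ext -ext_Neg. Qed.

Lemma iter_diaZ_ext n :
  iter n (@diaZ canonical_frame) setT = ext (iter n Dia Top).
Proof. by elim: n => [|n IH]; rewrite ?ext_Top//= IH diaZ_ext. Qed.

Lemma canonical_GL : GL_frame canonical_frame.
Proof.
split.
- by move=> X Y F [A FA]; rewrite subsetI => -[AX AY]; split; exists A.
- rewrite -[X in boxZ X]ext_Top boxZ_ext -subTset => F _.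
  by apply: henkin_QGL (svalP F) _; apply/QGL_nec/QGL_taut; split.
- move=> X Y F [[A FA AX] [B FB BY]]; exists (And A B).
    apply: henkin_imp (svalP F) _ _ (QGL_box_and A B) _.
    exact: henkin_and (svalP F) _ _ FA FB.
  by rewrite ext_And; apply: setISS.
(* Every world containing [Box A] has [X] as a neighborhood, so [ext (Box A)] lies inside [boxZ X]
   even if [X] is not definable. *)
- move=> X F [A FA AX]; exists (Box A).
    exact: henkin_imp (svalP F) _ _ (QGL_box4 A) FA.
  by move=> G GA; exists A.
- rewrite -subset0 => F h; have [n] := henkin_omega (svalP F); apply.
  by have := h n I; rewrite iter_diaZ_ext.
Qed.

Definition canonical_interp (n k : nat) (F : canonical_world) :
  set (n.-tuple var) := [set xs | sval F (Atom k xs)].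

Lemma truth_lemma (a : var -> var) phi :
  @valuation canonical_frame var canonical_interp a phi = ext (rename a phi).
Proof.
elim: phi a => //= [||phi IH1 psi IH2|phi IH|x phi IH|phi IH] a.
- by rewrite ext_Top.
- apply/esym; rewrite -subset0 -[ext _]setCK -ext_Neg => F; apply.
  by apply: henkin_QGL (svalP F) _; apply: QGL_taut; split=> // D I b _ [].
- by rewrite IH1 IH2 ext_And.
- by rewrite IH ext_Neg.
- rewrite ext_All; apply: eq_bigcapr => d _; rewrite IH.
  (* Instantiating the renamed binder by [d] composes two renamings; up to equivalence this is the
     renaming by [update x d a] of the induction hypothesis. *)
  have zP := avoid_notin x [seq a y | y <- fv (All x phi)].
  by rewrite (ext_equiv (rename_comp _ _ _)) (rename_ext (update_comp_update d id zP)).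
- by rewrite IH boxZ_ext.
Qed.

End Canonical.

Lemma completeness phi :
  (forall Z : nbhd_frame, GL_frame Z -> valid_in Z phi) -> QGL phi.
Proof.
move=> h; suff : QGL (Imp Top phi).
  by move=> /QGL_mp; apply; apply: QGL_taut; split.
apply: QGL_henkin => F hF _; pose F0 : canonical_world := exist _ F hF.
(* Under the identity assignment the truth lemma speaks of [phi] itself. *)
have := h _ (canonical_GL F0) var canonical_interp id (inhabits 0).
by rewrite truth_lemma rename_id => /seteqP[_ /(_ F0 I)].
Qed.

Theorem theorem6p3 (phi : formula) :
  QGL phi <-> (forall Z : nbhd_frame, GL_frame Z -> valid_in Z phi).
Proof. by split; [apply: soundness|apply: completeness]. Qed.
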